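(* For any $\alpha\ge1$, $F_t\in\mathbb A_t^{[\alpha]}\langle\langle z\rangle\rangle$ with inverse map $G_t=F_t^{-1}$, and any $u(z)\in K\langle\langle z\rangle\rangle$, we have $$u(F_t(z))=u(z)+\sum_{m\ge1}(-1)^mt^m\,\lambda_m\,u(z),$$ $$u(F_t(z))=u(z)+\sum_{m\ge1}t^m\sum_{I\in\mathcal C_m}\frac{(-1)^{\ell(I)}}{\pi_u(\bar I)}\,\psi^I\,u(z),$$ $$u(G_t(z))=u(z)+\sum_{m\ge1}t^m\sum_{I\in\mathcal C_m}(-1)^{\ell(I)-m}\,\lambda^I\,u(z),$$ $$u(G_t(z))=u(z)+\sum_{m\ge1}t^m\sum_{I\in\mathcal C_m}\frac{1}{\pi_u(I)}\,\psi^I\,u(z).$$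
   Context: $K$ is a unital commutative $\mathbb Q$-algebra, $z=(z_1,\dots,z_n)$ are commutative or noncommutative free variables, and $t$ is a formal parameter commuting with $z$ and $K$. $K\langle\langle z\rangle\rangle$ and $K[[t]]\langle\langle z\rangle\rangle$ are the formal power series algebras in $z$ over $K$ and $K[[t]]$ (in either the commutative or the noncommutative case); $o(\cdot)$ is the order in $z$. For a vector $\vec u=(u_1,\dots,u_n)$ of power series, $[\vec u\frac{\partial}{\partial z}]$ is the derivation sending $z_i$ to $u_i$. For $\alpha\ge1$, $\mathbb A_t^{[\alpha]}\langle\langle z\rangle\rangle$ is the set of automorphisms $F_t(z)=z-H_t(z)$ of $K[[t]]\langle\langle z\rangle\rangle$ over $K[[t]]$ with $o(H_t(z))\ge\alpha$ and $H_{t=0}(z)=0$. For such $F_t$ write the inverse map as $G_t(z)=z+M_t(z)$. Let $\mathcal D^{[\alpha]}\langle\langle z\rangle\rangle$ be the unital algebra generated by $K$-derivations of $K\langle\langle z\rangle\rangle$ that increase the degree in $z$ by at least $\alpha-1$. There is a unique $f(t)\in\mathcal D^{[\alpha]}\langle\langle z\rangle\rangle[[t]]$ with $f(0)=1$ and $f(-t)u_t(z)=u_t(F_t)$ for all $u_t(z)\in K[[t]]\langle\langle z\rangle\rangle$. Put $h(t)=[\frac{\partial M_t}{\partial t}(F_t)\frac{\partial}{\partial z}]$. Define differential operators $\lambda_m$ and $\psi_m$ by $f(t)=\sum_{m\ge0}t^m\lambda_m$ and $h(t)=\sum_{m\ge1}t^{m-1}\psi_m$. A composition is a nonempty finite sequence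 $I=(i_1,\dots,i_k)$ of positive integers; $\ell(I)=k$, $|I|=i_1+\cdots+i_k$, $\bar I=(i_k,\dots,i_1)$, and $\mathcal C_m$ is the set of compositions with $|I|=m$. For a sequence $w=\{w_j\}$, $w^I=w_{i_1}\cdots w_{i_k}$. $\pi_u(I)=\prod_{j=1}^k(i_1+\cdots+i_j)$. *)

(* Defs.v *)
From HB Require Import structures.
From mathcomp Require Import all_boot all_order all_algebra.
From mathcomp Require Import boolp.

Set Implicit Arguments.
Unset Strict Implicit.
Unset Printing Implicit Defensive.

Import GRing.Theory.

(* Monomials in n variables.  [mword] chooses for each monomial a word in the
   variables whose product is that monomial; its length is the degree.       *)
HB.mixin Record isMonomial (n : nat) T of Choice T := {
  mone : T;
  mmul : T -> T -> T;
  mvar : 'I_n -> T;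
  mword : T -> seq 'I_n;
  mmulA : associative mmul;
  mmul1m : left_id mone mmul;
  mmulm1 : right_id mone mmul;
  mwordK : forall a, foldr (fun i => mmul (mvar i)) mone (mword a) = a;
  size_mword_var : forall i, size (mword (mvar i)) = 1;
  size_mwordM : forall a b,
    size (mword (mmul a b)) = size (mword a) + size (mword b)
}.
#[short(type="monomType")]
HB.structure Definition Monomial n := { T of isMonomial n T & Choice T }.

HB.mixin Record isComMonomial (n : nat) T of Monomial n T := {
  mmulC : commutative (mmul : T -> T -> T)
}.
#[short(type="comMonomType")]
HB.structure Definition ComMonomial n :=
  { T of isComMonomial n T & Monomial n T }.

(* Powers of one variable t: the exponent. *)
Section NatMonomial.
Let mword (a : nat) : seq 'I_1 := nseq a ord0.
Let mvar (i : 'I_1) := 1%N.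
Let mwordK a : foldr (fun i => addn (mvar i)) 0 (mword a) = a.
Proof. by elim: a => //= a ->. Qed.
Let size_var i : size (mword (mvar i)) = 1. Proof. by []. Qed.
Let size_M a b : size (mword (a + b)) = size (mword a) + size (mword b).
Proof. by rewrite !size_nseq. Qed.
HB.instance Definition _ := isMonomial.Build 1 nat
  addnA add0n addn0 mwordK size_var size_M.
HB.instance Definition _ := isComMonomial.Build 1 nat addnC.
End NatMonomial.

(* Noncommutative monomials: words under concatenation. *)
Definition word (n : nat) := seq 'I_n.
HB.instance Definition _ n := Choice.on (word n).

Section WordMonomial.
Variable n : nat.
Let mwordK (a : word n) : foldr (fun i => cat [:: i]) [::] a = a.
Proof. by elim: a => //= i a ->. Qed.
Let size_M (a b : word n) : size (a ++ b) = size a + size b.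
Proof. exact: size_cat. Qed.
HB.instance Definition _ := isMonomial.Build n (word n) (mword := id)
  (mvar := fun i => [:: i])
  (@catA _) (@cat0s _) (@cats0 _) mwordK (fun _ => erefl) size_M.
End WordMonomial.

(* Commutative monomials: exponent vectors. *)
Definition multiindex (n : nat) := {ffun 'I_n -> nat}.
HB.instance Definition _ n := Choice.on (multiindex n).

Section MultiindexMonomial.
Variable n : nat.
Implicit Types a b c : multiindex n.
Let one : multiindex n := [ffun=> 0].
Let mul a b : multiindex n := [ffun i => a i + b i].
Let var (i : 'I_n) : multiindex n := [ffun j => (j == i) : nat].
Let wd a : seq 'I_n := flatten [seq nseq (a i) i | i <- enum 'I_n].
Let mulA : associative mul.
Proof. by move=> a b c; apply/ffunP => i; rewrite !ffunE addnA. Qed.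
Let mul1 : left_id one mul.
Proof. by move=> a; apply/ffunP => i; rewrite !ffunE. Qed.
Let mulr1 : right_id one mul.
Proof. by move=> a; apply/ffunP => i; rewrite !ffunE addn0. Qed.
Let mulC : commutative mul.
Proof. by move=> a b; apply/ffunP => i; rewrite !ffunE addnC. Qed.
Let wdK a : foldr (fun i => mul (var i)) one (wd a) = a.
Proof.
have foldE s i : foldr (fun i => mul (var i)) one s i = count_mem i s.
  by elim: s => [|j s IHs] /=; rewrite !ffunE // IHs eq_sym.
apply/ffunP => i; rewrite foldE count_flatten -map_comp sumnE big_map.
rewrite big_enum /= (bigD1 i) //= count_nseq /= eqxx mul1n big1 ?addn0 //.
by move=> j /negPf jDi; rewrite count_nseq /= jDi.
Qed.
Let size_wd a : size (wd a) = \sum_i a i.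
Proof.
rewrite size_flatten /shape -map_comp sumnE big_map big_enum /=.
by apply: eq_bigr => i _; rewrite size_nseq.
Qed.
Let size_var i : size (wd (var i)) = 1.
Proof.
rewrite size_wd (bigD1 i) //= ffunE eqxx big1 // => j /negPf jDi.
by rewrite ffunE jDi.
Qed.
Let size_M a b : size (wd (mul a b)) = size (wd a) + size (wd b).
Proof.
by rewrite !size_wd -big_split; apply: eq_bigr => i _; rewrite ffunE.
Qed.
HB.instance Definition _ := isMonomial.Build n (multiindex n)
  mulA mul1 mulr1 wdK size_var size_M.
HB.instance Definition _ := isComMonomial.Build n (multiindex n) mulC.
End MultiindexMonomial.

Variant variables := Commutative | Noncommutative.

Definition monom (v : variables) (n : nat) : monomType n :=
  match v with
  | Commutative => multiindex n
  | Noncommutative => word n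
  end.

Section MonomialTheory.
Variables (n : nat) (M : monomType n).
Implicit Types a b : M.

Definition mdeg a : nat := size (mword a).

(* The (finite, duplicate-free) list of the monomials of degree at most d. *)
Definition monoms (d : nat) : seq M :=
  undup (flatten [seq [seq foldr (fun i => mmul (mvar i)) mone (val w)
                         | w <- enum {: k.-tuple 'I_n}] | k <- iota 0 d.+1]).

Lemma mdegM a b : mdeg (mmul a b) = mdeg a + mdeg b.
Proof. exact: size_mwordM. Qed.

Lemma mdeg1 : mdeg (mone : M) = 0.
Proof.
have /eqP := mdegM mone mone.
by rewrite mmul1m -{1}[mdeg mone]addn0 eqn_add2l => /eqP/esym.
Qed.

Lemma mdeg_var i : mdeg (mvar i : M) = 1.
Proof. exact: size_mword_var. Qed.

Lemma monoms_uniq d : uniq (monoms d).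
Proof. exact: undup_uniq. Qed.

Lemma mem_monoms d a : (a \in monoms d) = (mdeg a <= d).
Proof.
have degE (s : seq 'I_n) :
    mdeg (foldr (fun i => mmul (mvar i)) (mone : M) s) = size s.
  by elim: s => [|i s IHs] /=; rewrite ?mdeg1 // mdegM IHs mdeg_var.
rewrite mem_undup; apply/flatten_mapP/idP => [[k] | le_ad].
  rewrite mem_iota add0n ltnS => le_kd /mapP[w _ ->].
  by rewrite degE size_tuple.
exists (mdeg a); first by rewrite mem_iota add0n ltnS.
apply/mapP; exists (@Tuple (mdeg a) _ (mword a) (eqxx _)).
  by rewrite mem_enum.
by rewrite /= mwordK.
Qed.

Lemma big_monoms_widen (V : nmodType) d e (F : M -> V) : d <= e ->
    (forall a, d < mdeg a -> F a = 0%R) ->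
  (\sum_(a <- monoms e) F a = \sum_(a <- monoms d) F a)%R.
Proof.
move=> le_de F0; rewrite (bigID (fun a => mdeg a <= d)) /= addrC.
rewrite big1 ?add0r => [|a]; last by rewrite -ltnNge => /F0.
rewrite -big_filter; apply/perm_big/uniq_perm; rewrite ?filter_uniq //;
  rewrite ?monoms_uniq // => a.
rewrite mem_filter !mem_monoms andb_idr // => /leq_trans; exact.
Qed.

End MonomialTheory.

Record series (n : nat) (M : monomType n) (R : Type) :=
  Series { coef :> M -> R }.

Local Open Scope ring_scope.

Section SeriesRing.
Variables (n : nat) (M : monomType n).

Lemma seriesP R (f g : series M R) : f =1 g -> f = g.
Proof. by case: f g => [f] [g] /= /funext ->. Qed.

HB.instance Definition _ R := gen_eqMixin (series M R).
HB.instance Definition _ R := gen_choiceMixin (series M R).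

Section Additive.
Variable R : zmodType.
Implicit Types f g h : series M R.
Definition series_zero : series M R := Series (fun=> 0).
Definition series_opp f := Series (fun a => - f a).
Definition series_add f g := Series (fun a => f a + g a).
Fact series_addA : associative series_add.
Proof. by move=> f g h; apply: seriesP => a /=; rewrite addrA. Qed.
Fact series_addC : commutative series_add.
Proof. by move=> f g; apply: seriesP => a /=; rewrite addrC. Qed.
Fact series_add0 : left_id series_zero series_add.
Proof. by move=> f; apply: seriesP => a /=; rewrite add0r. Qed.
Fact series_addN : left_inverse series_zero series_opp series_add.
Proof. by move=> f; apply: seriesP => a /=; rewrite addNr. Qed.
HB.instance Definition _ := GRing.isZmodule.Build (series M R)
  series_addA series_addC series_add0 series_addN.

Lemma coefD f g a : (f + g) a = f a + g a. Proof. by []. Qed.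
Lemma coefN f a : (- f) a = - f a. Proof. by []. Qed.
Lemma coef0 a : (0 : series M R) a = 0. Proof. by []. Qed.
End Additive.

Section Ring.
Variable R : nzRingType.
Implicit Types f g h : series M R.

Definition series_one : series M R := Series (fun a => (a == mone)%:R).

Definition series_mul f g : series M R :=
  Series (fun m => \sum_(a <- monoms M (mdeg m))
                   \sum_(b <- monoms M (mdeg m) | mmul a b == m) f a * g b).

Lemma series_mul_widen d f g m : (mdeg m <= d)%N ->
  series_mul f g m =
  \sum_(a <- monoms M d) \sum_(b <- monoms M d | mmul a b == m) f a * g b.
Proof.
move=> le_md; rewrite /= (big_monoms_widen le_md) => [|a lt_ma]; last first.
  rewrite big1 // => b /eqP def_m; move: lt_ma.
  by rewrite -def_m mdegM ltnNge leq_addr.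
apply: eq_bigr => a _.
rewrite big_mkcond [RHS]big_mkcond (big_monoms_widen le_md) // => b lt_mb.
by case: eqP lt_mb => // <-; rewrite mdegM ltnNge leq_addl.
Qed.

Fact series_mulA : associative series_mul.
Proof.
move=> f g h; apply: seriesP => m; set d := mdeg m.
have sum1 (x : M) (F : R) : (mdeg x <= d)%N ->
    \sum_(b <- monoms M d) (if x == b then F else 0) = F.
  move=> le_xd; rewrite -big_mkcond (big_rem x) ?mem_monoms //= eqxx.
  rewrite big1_seq ?addr0 // => b /andP[/eqP <-].
  by rewrite mem_rem_uniq ?monoms_uniq // !inE eqxx.
transitivity (\sum_(a <- monoms M d) \sum_(b <- monoms M d)
   \sum_(c <- monoms M d | mmul (mmul a b) c == m) f a * (g b * h c)).
  apply: eq_bigr => a _; transitivity (\sum_(x <- monoms M d)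
    \sum_(b <- monoms M d) \sum_(c <- monoms M d)
    if mmul b c == x then
      if mmul a (mmul b c) == m then f a * (g b * h c) else 0 else 0).
    rewrite big_mkcond [LHS]big_seq_cond [RHS]big_seq_cond.
    apply: eq_bigr => x; rewrite andbT mem_monoms => le_xd.
    rewrite (series_mul_widen _ _ le_xd).
    case: ifP => [/eqP axm | axm]; last first.
      rewrite big1 // => b _; rewrite big1 // => c _.
      by case: eqP => // ->; rewrite axm.
    rewrite mulr_sumr; apply: eq_bigr => b _; rewrite mulr_sumr big_mkcond.
    by apply: eq_bigr => c _; case: eqP => // ->; rewrite axm eqxx.
  rewrite exchange_big; apply: eq_bigr => b _.
  rewrite exchange_big [RHS]big_mkcond; apply: eq_bigr => c _.
  rewrite mmulA; case: eqP => [def_m | _]; last by rewrite big1 // => x; case: ifP.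
  by rewrite sum1 // /d -def_m -mmulA [mdeg (mmul a _)]mdegM leq_addl.
symmetry; transitivity (\sum_(x <- monoms M d) \sum_(c <- monoms M d)
  \sum_(a <- monoms M d) \sum_(b <- monoms M d)
    if mmul a b == x then
      if mmul (mmul a b) c == m then f a * (g b * h c) else 0 else 0).
  rewrite [LHS]big_seq_cond [RHS]big_seq_cond.
  apply: eq_bigr => x; rewrite andbT mem_monoms => le_xd.
  rewrite big_mkcond; apply: eq_bigr => c _.
  rewrite (series_mul_widen _ _ le_xd).
  case: ifP => [/eqP axm | axm]; last first.
    rewrite big1 // => a _; rewrite big1 // => b _.
    by case: eqP => // ->; rewrite axm.
  rewrite mulr_suml; apply: eq_bigr => a _; rewrite mulr_suml big_mkcond.
  by apply: eq_bigr => b _; case: eqP => // ->; rewrite axm eqxx mulrA.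
rewrite exchange_big /=.
under eq_bigr => c _ do rewrite exchange_big /=.
rewrite exchange_big /=; apply: eq_bigr => a _.
under eq_bigr => c _ do rewrite exchange_big /=.
rewrite exchange_big /=; apply: eq_bigr => b _.
rewrite [RHS]big_mkcond; apply: eq_bigr => c _.
case: eqP => [def_m | _]; last by rewrite big1 // => x; case: ifP.
by rewrite sum1 // /d -def_m [mdeg (mmul _ c)]mdegM leq_addr.
Qed.

Fact series_mul1 : left_id series_one series_mul.
Proof.
move=> f; apply: seriesP => m /=.
rewrite (big_rem mone) ?mem_monoms ?mdeg1 //= [X in _ + X]big1_seq => [|a].
  rewrite addr0 (big_rem m) ?mem_monoms //= mmul1m !eqxx mul1r.
  rewrite big1_seq ?addr0 // => b /andP[/eqP <-].
  by rewrite mem_rem_uniq ?monoms_uniq // !inE mmul1m eqxx.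
rewrite mem_rem_uniq ?monoms_uniq // => /andP[_]; rewrite !inE.
case/andP=> /negPf-> _.
by rewrite big1 // => b _; rewrite mul0r.
Qed.

Fact series_mulr1 : right_id series_one series_mul.
Proof.
move=> f; apply: seriesP => m /=.
transitivity (\sum_(a <- monoms M (mdeg m)) if a == m then f a else 0).
  apply: eq_bigr => a _; rewrite big_mkcond (big_rem mone) /=; last first.
    by rewrite mem_monoms mdeg1.
  rewrite mmulm1 eqxx mulr1 big1_seq ?addr0 // => b.
  rewrite mem_rem_uniq ?monoms_uniq // => /andP[_]; rewrite !inE.
  case/andP=> /negPf-> _.
  by rewrite mulr0 if_same.
rewrite -big_mkcond (big_rem m) ?mem_monoms //= eqxx.
rewrite big1_seq ?addr0 // => a /andP[/eqP->].
by rewrite mem_rem_uniq ?monoms_uniq // !inE eqxx.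
Qed.

Fact series_mulDl : left_distributive series_mul +%R.
Proof.
move=> f g h; apply: seriesP => m /=; rewrite -big_split; apply: eq_bigr => a _.
by rewrite -big_split; apply: eq_bigr => b _ /=; rewrite -mulrDl.
Qed.

Fact series_mulDr : right_distributive series_mul +%R.
Proof.
move=> f g h; apply: seriesP => m /=; rewrite -big_split; apply: eq_bigr => a _.
by rewrite -big_split; apply: eq_bigr => b _ /=; rewrite -mulrDr.
Qed.

Fact series_oner_neq0 : series_one != 0.
Proof.
apply/eqP => /(congr1 (fun f : series M R => f mone))/=/eqP.
by rewrite eqxx oner_eq0.
Qed.

HB.instance Definition _ := GRing.Zmodule_isNzRing.Build (series M R)
  series_mulA series_mul1 series_mulr1 series_mulDl series_mulDr
  series_oner_neq0.

Definition series_scale (c : R) f : series M R := Series (fun a => c * f a).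
Fact series_scaleA c d f :
  series_scale c (series_scale d f) = series_scale (c * d) f.
Proof. by apply: seriesP => a /=; rewrite mulrA. Qed.
Fact series_scale1 : left_id 1 series_scale.
Proof. by move=> f; apply: seriesP => a /=; rewrite mul1r. Qed.
Fact series_scaleDr : right_distributive series_scale +%R.
Proof. by move=> c f g; apply: seriesP => a /=; rewrite mulrDr. Qed.
Fact series_scaleDl f : {morph series_scale^~ f : c d / c + d}.
Proof. by move=> c d; apply: seriesP => a /=; rewrite mulrDl. Qed.
HB.instance Definition _ := GRing.Zmodule_isLmodule.Build R (series M R)
  series_scaleA series_scale1 series_scaleDr series_scaleDl.

Fact series_scaleAl c f g : c *: (f * g) = (c *: f) * g.
Proof.
apply: seriesP => m /=; rewrite mulr_sumr; apply: eq_bigr => a _.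
by rewrite mulr_sumr; apply: eq_bigr => b _; rewrite mulrA.
Qed.
HB.instance Definition _ :=
  GRing.Lmodule_isLalgebra.Build R (series M R) series_scaleAl.

Lemma coefZ c f a : (c *: f) a = c * f a. Proof. by []. Qed.
Lemma coef1 a : (1 : series M R) a = (a == mone)%:R. Proof. by []. Qed.
Lemma coefM f g m : (f * g) m =
  \sum_(a <- monoms M (mdeg m))
    \sum_(b <- monoms M (mdeg m) | mmul a b == m) f a * g b.
Proof. by []. Qed.

End Ring.

Section Algebra.
Variable R : comNzRingType.
Fact series_scaleAr (c : R) (f g : series M R) : c *: (f * g) = f * (c *: g).
Proof.
apply: seriesP => m /=; rewrite mulr_sumr; apply: eq_bigr => a _.
by rewrite mulr_sumr; apply: eq_bigr => b _; rewrite mulrCA.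
Qed.
HB.instance Definition _ :=
  GRing.Lalgebra_isAlgebra.Build R (series M R) series_scaleAr.
End Algebra.
End SeriesRing.

Section ComSeries.
Variables (n : nat) (M : comMonomType n) (R : comNzRingType).
Fact series_mulC : commutative (@series_mul n M R).
Proof.
move=> f g; apply: seriesP => m /=.
under eq_bigr => a _ do rewrite big_mkcond.
rewrite exchange_big /=; apply: eq_bigr => a _; rewrite [RHS]big_mkcond.
by apply: eq_bigr => b _; rewrite mmulC mulrC.
Qed.
HB.instance Definition _ :=
  GRing.PzRing_hasCommutativeMul.Build (series M R) series_mulC.
End ComSeries.

(* K[[t]]; the coefficient of t^j of c is [c j]. *)
Notation "{ 'tps' K }" := (series nat K) (format "{ 'tps'  K }").

Section Substitution.
Variables (n : nat) (M : monomType n) (R : comNzRingType).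
Implicit Types (f : series M R) (u F : 'I_n -> series M R).

Definition zvar (i : 'I_n) : series M R := Series (fun a => (a == mvar i)%:R).

(* o(f) >= k *)
Definition order_ge (k : nat) f := forall a : M, (mdeg a < k)%N -> f a = 0.

(* f(F).  When every F i has order at least 1, as is always the case below,
   only the monomials of f of degree at most [mdeg m] contribute to the
   coefficient of m.                                                         *)
Definition subst F f : series M R :=
  Series (fun m => \sum_(a <- monoms M (mdeg m))
                     f a * (\prod_(i <- mword a) F i) m).

(* The image of a monomial under the derivation [u d/dz], by the Leibniz
   rule: the sum over all letters of the monomial of the product in which
   that letter z_i is replaced by u i.                                       *)
Definition der_monom u (a : M) : series M R :=
  \sum_(k < size (mword a))
     (\prod_(i <- take k (mword a)) zvar i)
     * u (tnth (in_tuple (mword a)) k)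
     * (\prod_(i <- drop k.+1 (mword a)) zvar i).

(* The derivation [u d/dz].  It lowers the degree by at most one, hence the
   bound on the degree of the monomials of f which contribute.               *)
Definition der u f : series M R :=
  Series (fun m => \sum_(a <- monoms M (mdeg m).+1) f a * der_monom u a m).

End Substitution.
Arguments zvar {n M R} i.

Section DifferentialOperators.
Variables (n : nat) (M : monomType n) (K : comNzRingType).

Definition derivation (d : series M K -> series M K) : Prop :=
  linear d /\ forall u v, d (u * v) = d u * v + u * d v.

Definition raises_degree (k : nat) (d : series M K -> series M K) : Prop :=
  forall j u, order_ge j u -> order_ge (j + k) (d u).

(* The unital K-algebra generated by the K-derivations raising the degree by
   at least alpha - 1.                                                       *)
Inductive diffop (alpha : nat) : (series M K -> series M K) -> Prop :=
| diffop_der d :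
    derivation d -> raises_degree (alpha - 1) d -> diffop alpha d
| diffop_id : diffop alpha id
| diffop_scale (c : K) p : diffop alpha p -> diffop alpha (fun u => c *: p u)
| diffop_add p q :
    diffop alpha p -> diffop alpha q -> diffop alpha (fun u => p u + q u)
| diffop_comp p q : diffop alpha p -> diffop alpha q -> diffop alpha (p \o q).

(* w^I = w_(i_1) ... w_(i_k) *)
Definition oppow (w : nat -> series M K -> series M K) (I : seq nat) :
    series M K -> series M K :=
  foldr (fun i p => w i \o p) id I.

End DifferentialOperators.

Section Deformations.
Variables (n : nat) (M : monomType n) (K : comNzRingType).
Local Notation A := (series M K).
Local Notation At := (series M {tps K}).

(* The inclusion of K<<z>> in K[[t]]<<z>>. *)
Definition tconst (u : A) : At :=
  Series (fun a => Series (fun j => if j == 0%N then u a else 0)).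

(* The coefficient of t^j, in K<<z>>. *)
Definition tcoef (j : nat) (u : At) : A := Series (fun a => u a j).

(* d/dt *)
Definition tderiv (u : At) : At :=
  Series (fun a => Series (fun j => u a j.+1 *+ j.+1)).

(* The formal sum of the t^m c_m over m >= 0. *)
Definition tsum (c : nat -> A) : At :=
  Series (fun a => Series (fun j => c j a)).

(* The formal sum of the t^m c_m over m >= 1. *)
Definition tsum1 (c : nat -> A) : At :=
  tsum (fun m => if m == 0%N then 0 else c m).

(* The action on K[[t]]<<z>> of the operator sum_m t^m p_m. *)
Definition tact (p : nat -> A -> A) (u : At) : At :=
  tsum (fun m => \sum_(j < m.+1) p j (tcoef (m - j) u)).

(* z |-> F(z) as an automorphism over K[[t]] *)
Definition automorphism (F : 'I_n -> At) : Prop :=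
  exists2 phi : {lrmorphism At -> At}, bijective phi & phi =1 subst F.

(* F belongs to A_t^[alpha]; here H i = zvar i - F i. *)
Definition deformation (alpha : nat) (F : 'I_n -> At) : Prop :=
  [/\ automorphism F,
      forall i, order_ge alpha (zvar i - F i)
    & forall i, tcoef 0 (zvar i - F i) = 0].

Definition inverse_map (F G : 'I_n -> At) : Prop :=
  forall i, subst F (G i) = zvar i /\ subst G (F i) = zvar i.

(* The lambda_m are the coefficients of f(t) = sum_m t^m lambda_m in
   D^[alpha][[t]], with f(0) = 1 and f(-t) u = u(F). *)
Definition lambda_spec (alpha : nat) (F : 'I_n -> At) (lambda : nat -> A -> A)
    : Prop :=
  [/\ forall m, diffop alpha (lambda m),
      lambda 0%N =1 id
    & forall u : At, tact (fun m v => (-1) ^+ m *: lambda m v) u = subst F u].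

(* h(t) = [dM/dt (F) d/dz], with M i = G i - zvar i. *)
Definition hder (F G : 'I_n -> At) : At -> At :=
  der (fun i => subst F (tderiv (G i - zvar i))).

(* psi_m is the coefficient of t^(m-1) in h(t); meaningful for m >= 1 only. *)
Definition psi (F G : 'I_n -> At) (m : nat) (u : A) : A :=
  tcoef m.-1 (hder F G (tconst u)).

End Deformations.

Section Compositions.
Local Open Scope nat_scope.

(* The compositions of m of length k. *)
Fixpoint compositions_len (k m : nat) : seq (seq nat) :=
  if k is k'.+1 then
    [seq i :: J | i <- iota 1 m, J <- compositions_len k' (m - i)]
  else if m == 0 then [:: [::]] else [::].

(* C_m *)
Definition compositions (m : nat) : seq (seq nat) :=
  flatten [seq compositions_len k m | k <- iota 1 m].

Definition pi_u (I : seq nat) : nat :=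
  \prod_(j < size I) sumn (take j.+1 I).

Lemma mem_compositions_len k m I :
  (I \in compositions_len k m) = [&& size I == k, 0 \notin I & sumn I == m].
Proof.
elim: k m I => [|k IHk] m [|i I] /=.
- by rewrite eq_sym; case: eqP.
- by case: eqP.
- by apply/allpairsPdep => -[i [J []]].
apply/allpairsPdep/idP => [[j [J [+ + [-> ->]]]] | ].
  rewrite mem_iota IHk => /andP[j_gt0]; rewrite add1n ltnS => le_jm.
  case/and3P=> sJ J_gt0 /eqP sumJ.
  by rewrite eqSS sJ inE negb_or eq_sym -lt0n j_gt0 J_gt0 sumJ subnKC ?eqxx.
case/and3P=> sI; rewrite inE negb_or eq_sym -lt0n => /andP[i_gt0 I_gt0].
move=> /eqP def_m; exists i, I; split=> //.
  by rewrite mem_iota i_gt0 add1n ltnS -def_m leq_addr.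
by rewrite IHk I_gt0 -def_m addKn eqxx !andbT.
Qed.

Lemma mem_compositions m I :
  (I \in compositions m) = [&& I != [::], 0 \notin I & sumn I == m].
Proof.
apply/flatten_mapP/idP => [[k] | ].
  rewrite mem_iota mem_compositions_len => /andP[k_gt0 _] /and3P[/eqP sI -> ->].
  by rewrite -size_eq0 sI -lt0n k_gt0.
case/and3P=> I0 I_gt0 /eqP def_m; exists (size I); last first.
  by rewrite mem_compositions_len I_gt0 def_m !eqxx.
rewrite mem_iota lt0n size_eq0 I0 add1n ltnS -{}def_m.
elim: I I_gt0 {I0} => //= i I IHI; rewrite inE negb_or eq_sym -lt0n.
by case/andP=> i_gt0 /IHI leI; rewrite -add1n leq_add.
Qed.

Lemma compositions_uniq m : uniq (compositions m).
Proof.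
have uniq_len k p : uniq (compositions_len k p).
  elim: k p => [|k IHk] p /=; first by case: eqP.
  by apply: allpairs_uniq_dep; rewrite ?iota_uniq // => -[i I] [j J] _ _ [-> ->].
rewrite /compositions; elim: (iota 1 m) (iota_uniq 1 m) => //= k s IHs.
case/andP=> s'k /IHs us; rewrite cat_uniq uniq_len us andbT.
apply/hasPn => I /flatten_mapP[j sj]; rewrite /= !mem_compositions_len.
by case/and3P=> /eqP -> _ _; apply: contra s'k => /andP[/eqP <-].
Qed.

End Compositions.

(* Main.v *)
Require Import Defs.
From HB Require Import structures.
From mathcomp Require Import all_boot all_order all_algebra.
From mathcomp Require Import boolp.

Set Implicit Arguments.
Unset Strict Implicit.
Unset Printing Implicit Defensive.

Import GRing.Theory.
Local Open Scope ring_scope.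

(** Let [phi = subst F] and [g = subst G].  The expansion of [phi] by
    the [lambda_m] is their definition; the other three expansions solve
    recursions on the coefficients of [t^m] by sums over compositions.

    Since [g] is a right inverse of [phi] ([substK]), the definition of the
    [lambda_m] applied to [g u] gives
      [u = sum_j (-t)^j lambda_j (g u)],
    which determines each coefficient of [g u] from the earlier ones.

    For the [psi_m], the key is the chain rule [tderiv_subst]:
      [d/dt (g x) = g (dx/dt + h x)],   where [h = sum_m t^(m-1) psi_m].
    It holds because [h] is chosen so that [g (h z_i) = dG_i/dt], so that both
    sides agree on monomials by the Leibniz rule, and because each coefficient
    of either side involves finitely many monomials of [x].  For [x = u] it
    reads [d/dt (g u) = g (h u)]; for [x = phi u], where [g x = u] does not
    depend on [t], it reads [d/dt (phi u) = - h (phi u)].  Comparing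
    coefficients of [t^m],
      [(m+1) g_(m+1)   =   sum_i g_(m-i) psi_(i+1)],
      [(m+1) phi_(m+1) = - sum_i psi_(i+1) phi_(m-i)].
    Unfolding the first recursion adds parts at the right end of a composition
    and divides by each partial sum in turn ([right_recursion]); the second adds
    parts at the left end, whence the reversed composition ([left_recursion]).
    The factor [m+1] is invertible as K is a Q-algebra.

    The map [g] inherits multiplicativity from [phi], which is injective; the
    only analytic point is that the truncated sum defining [subst G] is the
    full substitution, which needs every [G i] to have order at least 1.  This
    follows from [subst F (G i) = z_i], because substitution preserves the
    constant coefficient ([inverse_order_ge1]). *)

(** * Compositions by their first or last part *)

Section Compositions.
Local Open Scope nat_scope.

(** Recursions start at the empty composition of 0, which [compositions]
    leaves out. *)
Definition compositions0 (m : nat) : seq (seq nat) :=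
  if m == 0 then [:: [::]] else compositions m.

Lemma mem_compositions0 m I :
  (I \in compositions0 m) = (0 \notin I) && (sumn I == m).
Proof.
rewrite /compositions0; case: eqP => [->|/eqP m0].
  rewrite inE; case: I => [|[|i] I] //=.
  by rewrite addSn andbF.
rewrite mem_compositions; case: I => [|i I] //=.
by rewrite eq_sym (negPf m0).
Qed.

Lemma compositions0_uniq m : uniq (compositions0 m).
Proof.
by rewrite /compositions0; case: eqP => // _; apply: compositions_uniq.
Qed.

Lemma perm_compositions0_cons m :
  perm_eq (compositions0 m.+1)
    [seq i.+1 :: J | i <- iota 0 m.+1, J <- compositions0 (m - i)].
Proof.
apply: uniq_perm; first exact: compositions0_uniq.
  apply: allpairs_uniq_dep => [|i _|[i I] [j J] _ _ /= [-> ->]] //.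
    exact: iota_uniq.
  exact: compositions0_uniq.
move=> I; rewrite mem_compositions0; apply/andP/allpairsPdep => [[]|].
  case: I => [|[|i] I]; rewrite ?inE // negb_or => /andP[_ I0].
  rewrite -[sumn _]/(i + sumn I).+1 eqSS => /eqP <-; exists i, I; split=> //.
    by rewrite mem_iota ltnS leq_addr.
  by rewrite mem_compositions0 I0 addKn eqxx.
case=> i [J [+ + ->]]; rewrite mem_iota ltnS mem_compositions0.
by move=> le_im /andP[J0 /eqP sJ]; rewrite inE negb_or J0 /= sJ addSn subnKC.
Qed.

Lemma perm_compositions0_rev m :
  perm_eq (map rev (compositions0 m)) (compositions0 m).
Proof.
apply: uniq_perm; rewrite ?map_inj_uniq ?compositions0_uniq //.
  exact: (can_inj revK).
move=> I; rewrite -[I in LHS]revK mem_map; last exact: (can_inj revK).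
by rewrite !mem_compositions0 mem_rev sumn_rev.
Qed.

(** The last partial sum is the total; this is the denominator [m+1] which
    the recursions on the coefficients produce. *)
Lemma pi_u_rcons J i : pi_u (rcons J i) = pi_u J * (sumn J + i).
Proof.
rewrite /pi_u size_rcons big_ord_recr /=; congr (_ * _).
  by apply: eq_bigr => j _; rewrite -cats1 takel_cat.
by rewrite take_oversize ?size_rcons // -cats1 sumn_cat /= addn0.
Qed.

End Compositions.

Section SumCompositions.
Variable V : nmodType.

Lemma sum_compositions0_cons m (f : seq nat -> V) :
  \sum_(I <- compositions0 m.+1) f I =
  \sum_(i < m.+1) \sum_(J <- compositions0 (m - i)) f (i.+1 :: J).
Proof.
rewrite (perm_big _ (perm_compositions0_cons m)) big_allpairs_dep.
by rewrite -[iota 0 m.+1]/(index_iota 0 m.+1) big_mkord.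
Qed.

Lemma sum_compositions0_rcons m (f : seq nat -> V) :
  \sum_(I <- compositions0 m.+1) f I =
  \sum_(i < m.+1) \sum_(J <- compositions0 (m - i)) f (rcons J i.+1).
Proof.
rewrite -(perm_big _ (perm_compositions0_rev m.+1)) big_map.
rewrite sum_compositions0_cons; apply: eq_bigr => i _.
rewrite -(perm_big _ (perm_compositions0_rev (m - i))) big_map.
by apply: eq_bigr => J _; rewrite rev_cons revK.
Qed.

End SumCompositions.

(** * Operator recursions solved by sums over compositions *)

Section Recursions.
Variables (n : nat) (M : monomType n) (K : comNzRingType).
Local Notation A := (series M K).
Variables (w : nat -> A -> A) (b : nat -> nat -> K) (c : seq nat -> K).
Hypothesis c_nil : c [::] = 1.

Lemma oppow_rcons I i u : oppow w (rcons I i) u = oppow w I (w i u).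
Proof. by elim: I => //= j I IH; rewrite IH. Qed.

(** Each step puts a new first part in front of a composition, and the operator
    of that part acts last; linearity moves it inside the sum. *)
Lemma left_recursion (x : nat -> A) :
    (forall m, linear (w m)) ->
    (forall i J, c (i.+1 :: J) = b (i + sumn J) i * c J) ->
    (forall m, x m.+1 = \sum_(i < m.+1) b m i *: w i.+1 (x (m - i)%N)) ->
  forall m, x m = \sum_(I <- compositions0 m) c I *: oppow w I (x 0%N).
Proof.
move=> w_lin c_cons x_rec m; elim/ltn_ind: m => -[_|m IH].
  by rewrite /compositions0 /= big_seq1 c_nil scale1r.
rewrite x_rec sum_compositions0_cons; apply: eq_bigr => i _.
pose wL := GRing.isLinear.Build _ _ _ _ _ (w_lin i.+1).
pose W : {linear A -> A} := HB.pack (w i.+1) wL.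
rewrite -[w i.+1]/(W : A -> A) IH ?ltnS ?leq_subr // linear_sum scaler_sumr.
apply: eq_big_seq => J; rewrite mem_compositions0 => /andP[_ /eqP sJ].
by rewrite c_cons sJ subnKC -1?ltnS // -scalerA linearZ.
Qed.

(** Here the operator of the new part acts first, on the argument, so the
    recursion has to be followed for all arguments at once, and new parts
    appear at the end. *)
Lemma right_recursion (X : nat -> A -> A) :
    X 0%N =1 id ->
    (forall i J, c (rcons J i.+1) = b (i + sumn J) i * c J) ->
    (forall m u, X m.+1 u = \sum_(i < m.+1) b m i *: X (m - i)%N (w i.+1 u)) ->
  forall m u, X m u = \sum_(I <- compositions0 m) c I *: oppow w I u.
Proof.
move=> X0 c_rcons X_rec m; elim/ltn_ind: m => -[_|m IH] u.
  by rewrite /compositions0 /= big_seq1 c_nil scale1r X0.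
rewrite X_rec sum_compositions0_rcons; apply: eq_bigr => i _.
rewrite IH ?ltnS ?leq_subr // scaler_sumr.
apply: eq_big_seq => J; rewrite mem_compositions0 => /andP[_ /eqP sJ].
by rewrite c_rcons sJ subnKC -1?ltnS // scalerA oppow_rcons.
Qed.

End Recursions.

(** * Order of series and truncation of substitutions *)

Section SeriesTheory.
Variables (n : nat) (M : monomType n) (R : comNzRingType).
Local Notation S := (series M R).
Implicit Types (f g : S) (F G : 'I_n -> S) (a b m : M).

Lemma series_sumE I (r : seq I) (P : pred I) (f : I -> S) m :
  (\sum_(i <- r | P i) f i) m = \sum_(i <- r | P i) f i m.
Proof. by elim/big_rec2: _ => // i y1 y2 _ <-. Qed.

Lemma order_geM j k f g :
  order_ge j f -> order_ge k g -> order_ge (j + k) (f * g).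
Proof.
move=> fj gk m lt_m; rewrite Defs.coefM big1 // => a _.
rewrite big1 // => b /eqP abm.
case: (ltnP (mdeg a) j) => [/fj->|le_ja]; first by rewrite mul0r.
rewrite gk ?mulr0 // ltnNge; apply/negP => le_kb; move: lt_m.
by rewrite -abm mdegM ltnNge leq_add.
Qed.

Lemma order_ge_prod F s :
  (forall i, order_ge 1 (F i)) -> order_ge (size s) (\prod_(i <- s) F i).
Proof.
move=> F1; elim: s => [|i s IH]; first by move=> a.
by rewrite big_cons -[size _]/(1 + size s)%N; apply: order_geM.
Qed.

Lemma order_ge_zvar i : order_ge 1 (zvar i : S).
Proof.
move=> a; rewrite ltnS leqn0 /= => /eqP a0.
by case: eqP => // aE; move: a0; rewrite aE mdeg_var.
Qed.

(** A derivation replaces one letter, so it may lower the degree by one,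
    whatever the order of the [F i]. *)
Lemma order_ge_der_monom F a : order_ge (mdeg a).-1 (der_monom F a).
Proof.
move=> m lt_m; rewrite /der_monom series_sumE big1 // => k _.
have zp s : order_ge (size s) (\prod_(i <- s) (zvar i : S)).
  exact: order_ge_prod order_ge_zvar.
have F0 : order_ge 0 (F (tnth (in_tuple (mword a)) k)) by [].
apply: order_geM (order_geM (zp _) F0) (zp _) _ _.
rewrite addn0 size_drop size_takel; last exact: ltnW.
by rewrite (leq_trans lt_m) // -subn1 leq_subLR addnA add1n subnKC.
Qed.

(** With [mwordK], the product over the letters of a monomial is that
    monomial, also when the variables commute. *)
Lemma prod_zvar s : \prod_(i <- s) (zvar i : S) =
  Series (fun b => (b == foldr (fun i => mmul (mvar i)) mone s)%:R).
Proof.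
elim: s => [|i s IH]; first by rewrite big_nil.
rewrite big_cons IH; apply: seriesP => m; rewrite Defs.coefM /=.
set p := foldr _ _ s; case: eqP => [mE|mE].
  rewrite (bigD1_seq (mvar i)) ?monoms_uniq ?mem_monoms //=; last first.
    by rewrite mE mdegM leq_addr.
  rewrite [X in _ + X]big1 ?addr0 => [|a /negPf ai]; last first.
    by rewrite big1 // => b _; rewrite ai mul0r.
  rewrite big_mkcond (bigD1_seq p) ?monoms_uniq ?mem_monoms //=; last first.
    by rewrite mE mdegM leq_addl.
  rewrite mE !eqxx mulr1 big1 ?addr0 // => b /negPf bp.
  by rewrite bp mulr0 if_same.
rewrite big1 // => a _; rewrite big1 // => b /eqP abm.
case: eqP => [ai|]; last by rewrite mul0r.
case: eqP => [bp|]; last by rewrite mulr0.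
by case: mE; rewrite -abm ai bp.
Qed.

Fact subst_is_linear F : linear (subst F).
Proof.
move=> c f g; apply: seriesP => m /=; rewrite mulr_sumr -big_split.
by apply: eq_bigr => a _ /=; rewrite mulrDl mulrA.
Qed.
HB.instance Definition _ F :=
  GRing.isLinear.Build R S S _ (subst F) (subst_is_linear F).

Lemma substZ F c f : subst F (c *: f) = c *: subst F f.
Proof. exact: linearZ. Qed.

Lemma substD F f g : subst F (f + g) = subst F f + subst F g.
Proof. exact: linearD. Qed.

Lemma subst_sum F I (r : seq I) (f : I -> S) :
  subst F (\sum_(i <- r) f i) = \sum_(i <- r) subst F (f i).
Proof. exact: linear_sum. Qed.

(** Substitution is continuous by construction: it reads coefficients of degree
    at most that of the output. *)
Lemma eq_subst F f g m :
  (forall a, (mdeg a <= mdeg m)%N -> f a = g a) -> subst F f m = subst F g m.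
Proof.
move=> fg; apply: eq_big_seq => a; rewrite mem_monoms => /fg /= ->; by [].
Qed.

(** A product of [mdeg a] series without constant term starts in degree
    [mdeg a], so longer ranges of summation add nothing; a common range for
    several coefficients makes [subst F f] a finite combination of products. *)
Lemma subst_widen F f m d :
    (forall i, order_ge 1 (F i)) -> (mdeg m <= d)%N ->
  subst F f m = (\sum_(a <- monoms M d) f a *: \prod_(i <- mword a) F i) m.
Proof.
move=> F1 le_md; rewrite series_sumE.
rewrite [RHS](big_monoms_widen le_md) => [|a lt_a]; first by apply: eq_bigr.
by rewrite Defs.coefZ (order_ge_prod F1) ?mulr0.
Qed.

Lemma der_widen F f m d : (mdeg m <= d)%N ->
  der F f m = (\sum_(a <- monoms M d.+1) f a *: der_monom F a) m.
Proof.
move=> le_md; rewrite series_sumE.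
rewrite [RHS](@big_monoms_widen _ _ _ (mdeg m).+1) => [|//|a lt_a].
  by apply: eq_bigr.
rewrite Defs.coefZ order_ge_der_monom ?mulr0 //.
by rewrite -ltnS prednK // (leq_trans _ lt_a).
Qed.

End SeriesTheory.

(** * The inverse substitution *)

Section Inverse.
Variables (n : nat) (M : monomType n) (R : comNzRingType).
Local Notation S := (series M R).
Variables F G : 'I_n -> S.
Hypothesis substFM : monoid_morphism (subst F).
Hypothesis substF_inj : injective (subst F).
Hypothesis FG : forall i, subst F (G i) = zvar i.

Lemma subst_mone (f : S) : subst F f mone = f mone.
Proof.
rewrite /= mdeg1 (bigD1_seq mone) ?monoms_uniq ?mem_monoms ?mdeg1 //=.
have /eqP : size (mword (mone : M)) = 0%N by rewrite -[LHS]/(mdeg _) mdeg1.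
rewrite size_eq0 => /eqP ->; rewrite big_nil Defs.coef1 eqxx mulr1.
rewrite big1_seq ?addr0 // => a /andP[aD1]; rewrite mem_monoms leqn0 size_eq0.
by move=> /eqP a0; case/eqP: aD1; rewrite -[a]mwordK a0.
Qed.

Lemma order_ge1 (f : S) : f mone = 0 -> order_ge 1 f.
Proof.
move=> f0 a; rewrite ltnS leqn0 size_eq0 => /eqP a0.
by rewrite -[a]mwordK a0.
Qed.

(** The constant coefficient of [G i] survives in [subst F (G i)], which is
    the variable [z_i]. *)
Lemma inverse_order_ge1 i : order_ge 1 (G i).
Proof.
by apply: order_ge1; rewrite -subst_mone FG order_ge_zvar // mdeg1.
Qed.

(** Modulo degrees above that of [m], the series [subst G f] is a finite
    combination of products of the [G i], and [subst F] sends such a product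
    to the corresponding monomial. *)
Lemma substK : cancel (subst G) (subst F).
Proof.
have [F1 FM] := substFM.
move=> f; apply: seriesP => m; set d := mdeg m.
have FX s : subst F (\prod_(i <- s) G i) = \prod_(i <- s) zvar i.
  elim: s => [|i s IH]; first by rewrite !big_nil.
  by rewrite !big_cons FM FG IH.
rewrite (@eq_subst _ _ _ F _
  (\sum_(a <- monoms M d) f a *: \prod_(i <- mword a) G i));
  last by move=> a; apply: subst_widen inverse_order_ge1.
rewrite subst_sum series_sumE.
have zE a : subst F (f a *: \prod_(i <- mword a) G i) m = f a * (m == a)%:R.
  by rewrite substZ FX Defs.coefZ prod_zvar /= mwordK.
under eq_bigr => a _ do rewrite zE.
rewrite (bigD1_seq m) ?monoms_uniq ?mem_monoms //= eqxx mulr1.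
by rewrite big1 ?addr0 // => a; rewrite eq_sym => /negPf->; rewrite mulr0.
Qed.

Lemma substKV : cancel (subst F) (subst G).
Proof. by move=> f; apply: substF_inj; rewrite substK. Qed.

Lemma substGM : monoid_morphism (subst G).
Proof.
have [F1 FM] := substFM.
by split=> [|f g]; apply: substF_inj; rewrite ?FM !substK ?F1.
Qed.

Lemma substG_zvar i : subst G (zvar i) = G i.
Proof. by rewrite -FG substKV. Qed.

End Inverse.

(** * Differentiation in the parameter *)

Section TPS.
Variable K : comNzRingType.
Implicit Types c d : {tps K}.

Lemma coefM_tps c d j : (c * d) j = \sum_(i < j.+1) c i * d (j - i)%N.
Proof.
have sM k i : (i \in monoms nat k) = (i <= k)%N.
  by rewrite mem_monoms /mdeg /mword /= size_nseq.
have dj : mdeg (j : nat) = j by rewrite /mdeg /mword /= size_nseq.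
rewrite Defs.coefM dj (perm_big (iota 0 j.+1)); last first.
  apply: uniq_perm => [||i]; [exact: monoms_uniq | exact: iota_uniq |].
  by rewrite sM mem_iota.
rewrite -[iota 0 j.+1]/(index_iota 0 j.+1) big_mkord; apply: eq_bigr => i _.
have le_ij : (i <= j)%N by rewrite -ltnS.
rewrite big_mkcond (bigD1_seq (j - i)%N) ?monoms_uniq ?sM ?leq_subr //=.
have mE a b : @mmul 1 nat a b = (a + b)%N by [].
rewrite mE subnKC // eqxx big1 ?addr0 // => k /negPf kN.
case: eqP => // /(congr1 (subn^~ i)); rewrite mE addKn => kE.
by rewrite kE eqxx in kN.
Qed.

Definition tps_deriv c : {tps K} := Series (fun j => c j.+1 *+ j.+1).

Fact tps_deriv_is_zmod : zmod_morphism tps_deriv.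
Proof. by move=> c d; apply: seriesP => j /=; rewrite mulrnBl. Qed.
HB.instance Definition _ :=
  GRing.isZmodMorphism.Build {tps K} {tps K} tps_deriv tps_deriv_is_zmod.

Lemma tps_derivM c d : tps_deriv (c * d) = tps_deriv c * d + c * tps_deriv d.
Proof.
have derivE (e : {tps K}) k : tps_deriv e k = e k.+1 *+ k.+1 by [].
apply: seriesP => j; rewrite Defs.coefD derivE !coefM_tps.
(* The factor [j.+1] is split as [i + (j.+1 - i)] in each term. *)
transitivity (\sum_(i < j.+2) (c i *+ i) * d (j.+1 - i)%N +
              \sum_(i < j.+2) c i * (d (j.+1 - i)%N *+ (j.+1 - i))).
  rewrite -big_split -sumrMnl; apply: eq_bigr => i _ /=.
  by rewrite mulrnAl mulrnAr -mulrnDr subnKC // -ltnS.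
congr (_ + _).
  by rewrite big_ord_recl /= mulr0n mul0r add0r.
rewrite big_ord_recr /= subnn mulr0n mulr0 addr0; apply: eq_bigr => i _.
by rewrite subSn // -ltnS.
Qed.

End TPS.

Section ParameterTheory.
Variables (n : nat) (M : monomType n) (K : comNzRingType).
Local Notation A := (series M K).
Local Notation At := (series M {tps K}).
Implicit Types (x y : At) (u : A) (F G : 'I_n -> At).

Lemma tcoefP x y : (forall j, tcoef j x = tcoef j y) -> x = y.
Proof.
move=> xy; apply: seriesP => a; apply: seriesP => j.
exact: (congr1 (fun u : A => u a) (xy j)).
Qed.

Lemma tcoef_tconst j u : tcoef j (tconst u) = if j == 0%N then u else 0.
Proof. by apply: seriesP => a /=; case: eqP. Qed.

Lemma tcoefD j x y : tcoef j (x + y) = tcoef j x + tcoef j y.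
Proof. by apply: seriesP. Qed.

Lemma tcoefN j x : tcoef j (- x) = - tcoef j x.
Proof. by apply: seriesP. Qed.

Lemma tcoef_tsum j c : tcoef j (tsum c : At) = c j.
Proof. by apply: seriesP. Qed.

Lemma tcoef_tderiv j x : tcoef j (tderiv x) = tcoef j.+1 x *+ j.+1.
Proof.
apply: seriesP => a.
suff mulrnE (v : A) k : (v *+ k) a = v a *+ k by rewrite mulrnE.
by elim: k => // k IH; rewrite !mulrSr -IH.
Qed.

Lemma tsum1_expansion x u c : tcoef 0 x = u ->
  (forall m, tcoef m.+1 x = c m.+1) -> x = tconst u + tsum1 c.
Proof.
move=> x0 xS; apply: tcoefP => -[|j]; rewrite tcoefD tcoef_tconst tcoef_tsum.
  by rewrite addr0.
by rewrite add0r.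
Qed.

(** The common form of [subst F] and [der u], where [X a] is the image of the
    monomial [a] and [r m] a finite range that contains all the monomials
    contributing to the coefficient of [m]. *)
Definition kernel_op (r : M -> seq M) (X : M -> At) x : At :=
  Series (fun m => \sum_(a <- r m) x a * X a m).

Section KernelOp.
Variables (r : M -> seq M) (X : M -> At).

Lemma kernel_op_tconst j u a :
  tcoef j (kernel_op r X (tconst u)) a = \sum_(b <- r a) u b * X b a j.
Proof.
rewrite /= series_sumE; apply: eq_bigr => b _.
rewrite coefM_tps big_ord_recl /=.
by rewrite subn0 big1 ?addr0 // => i _; rewrite mul0r.
Qed.

Lemma kernel_op_linear j : linear (fun u => tcoef j (kernel_op r X (tconst u))).
Proof.
move=> c u v; apply: seriesP => a; rewrite Defs.coefD Defs.coefZ.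
rewrite !kernel_op_tconst mulr_sumr -big_split; apply: eq_bigr => b _.
by rewrite Defs.coefD Defs.coefZ mulrDl mulrA.
Qed.

(** Such operators are K[[t]]-linear and t-adically continuous, hence are power
    series in [t] of operators on K<<z>>; this is the coefficient form of
    their action. *)
Lemma tcoef_kernel_op j x : tcoef j (kernel_op r X x) =
  \sum_(i < j.+1) tcoef (j - i) (kernel_op r X (tconst (tcoef i x))).
Proof.
apply: seriesP => a; rewrite series_sumE.
under [RHS]eq_bigr => i _ do rewrite kernel_op_tconst.
rewrite exchange_big /= series_sumE; apply: eq_bigr => b _.
by rewrite coefM_tps.
Qed.

End KernelOp.

Lemma coef_tderiv x a : tderiv x a = tps_deriv (x a).
Proof. by []. Qed.

Fact tderiv_is_zmod : zmod_morphism (@tderiv n M K).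
Proof.
move=> x y; apply: seriesP => a.
exact: (raddfB (@tps_deriv K) (x a) (y a)).
Qed.
HB.instance Definition _ :=
  GRing.isZmodMorphism.Build At At (@tderiv n M K) tderiv_is_zmod.

Lemma tderivB x y : tderiv (x - y) = tderiv x - tderiv y.
Proof. exact: raddfB. Qed.

Lemma tderiv_sum I (r : seq I) (f : I -> At) :
  tderiv (\sum_(i <- r) f i) = \sum_(i <- r) tderiv (f i).
Proof. exact: raddf_sum. Qed.

Lemma tderivM x y : tderiv (x * y) = tderiv x * y + x * tderiv y.
Proof.
apply: seriesP => m; rewrite Defs.coefD coef_tderiv !Defs.coefM.
rewrite raddf_sum -big_split; apply: eq_bigr => a _ /=.
rewrite raddf_sum -big_split; apply: eq_bigr => b _ /=.
by rewrite tps_derivM.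
Qed.

Lemma tderivZ c x : tderiv (c *: x) = tps_deriv c *: x + c *: tderiv x.
Proof. by apply: seriesP => a; apply: tps_derivM. Qed.

Lemma tderiv_tconst u : tderiv (tconst u) = 0.
Proof. by apply: seriesP => a; apply: seriesP => j; apply: mul0rn. Qed.

Lemma tderiv_zvar i : tderiv (zvar i : At) = 0.
Proof.
apply: seriesP => a; apply: seriesP => j /=.
by case: (a == _); rewrite /= ?mul0rn.
Qed.

Lemma tderiv_prod G s : tderiv (\prod_(i <- s) G i) =
  \sum_(k < size s) (\prod_(i <- take k s) G i)
     * tderiv (G (tnth (in_tuple s) k)) * \prod_(i <- drop k.+1 s) G i.
Proof.
elim: s => [|i s IH].
  rewrite big_nil big_ord0 -[RHS](tderiv_tconst 1); congr tderiv.
  by apply: seriesP => a; apply: seriesP => j /=; case: (a == _); case: j.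
rewrite big_cons tderivM IH big_ord_recl /= big_nil mul1r drop0; congr (_ + _).
rewrite mulr_sumr; apply: eq_bigr => k _ /=.
by rewrite big_cons !mulrA !(tnth_nth i).
Qed.

End ParameterTheory.

(** * The flow equation *)

Section Flow.
Variables (n : nat) (M : monomType n) (K : comNzRingType).
Local Notation At := (series M {tps K}).
Variables F G : 'I_n -> At.
Hypothesis substFM : monoid_morphism (subst F).
Hypothesis substF_inj : injective (subst F).
Hypothesis FG : forall i, subst F (G i) = zvar i.

(** The vector field of [hder] is the pullback by [F] of the velocity of [G],
    and [subst G] undoes the pullback. *)
Lemma subst_der_monom a :
  subst G (der_monom (fun i => subst F (tderiv (G i - zvar i))) a) =
  tderiv (\prod_(i <- mword a) G i).
Proof.
have [G1 GM] := substGM substFM substF_inj FG.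
have GX s : subst G (\prod_(i <- s) zvar i) = \prod_(i <- s) G i.
  elim: s => [|i s IH]; first by rewrite !big_nil.
  by rewrite !big_cons GM IH (substG_zvar substFM substF_inj FG).
rewrite tderiv_prod subst_sum; apply: eq_bigr => k _.
by rewrite !GM !GX (substKV substFM substF_inj FG) tderivB tderiv_zvar subr0.
Qed.

(** The chain rule.  The coefficient of [m] involves monomials of [x] of degree
    up to [(mdeg m).+1], as [hder] may lower the degree by one; with this
    common range, the identity reduces to one monomial with a coefficient
    in K[[t]]. *)
Lemma tderiv_subst (x : At) :
  tderiv (subst G x) = subst G (tderiv x + hder F G x).
Proof.
apply: seriesP => m; set d := mdeg m.
have G1 := inverse_order_ge1 FG.
have le_dm : (mdeg m <= d.+1)%N by [].
rewrite substD Defs.coefD coef_tderiv.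
rewrite [in RHS](@eq_subst _ _ _ G (hder F G x)
  (\sum_(a <- monoms M d.+1)
      x a *: der_monom (fun i => subst F (tderiv (G i - zvar i))) a));
  last by move=> a; apply: der_widen.
rewrite subst_sum !(subst_widen _ G1 le_dm) -Defs.coefD -big_split.
rewrite -coef_tderiv tderiv_sum !series_sumE; apply: eq_bigr => a _.
by rewrite tderivZ substZ subst_der_monom.
Qed.

(** [d/dt (g u) = g (h u)], since [u] does not depend on [t]. *)
Lemma tcoef_subst_inverse u m :
  tcoef m.+1 (subst G (tconst u)) *+ m.+1 =
  \sum_(i < m.+1) tcoef (m - i) (subst G (tconst (psi F G i.+1 u))).
Proof.
rewrite -tcoef_tderiv tderiv_subst tderiv_tconst add0r.
exact: tcoef_kernel_op.
Qed.

(** [d/dt (phi u) = - h (phi u)]: the chain rule at [phi u], whose image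
    under [g] is constant in [t], gives an element of the kernel of [g]. *)
Lemma tcoef_subst_direct u m :
  tcoef m.+1 (subst F (tconst u)) *+ m.+1 =
  - \sum_(i < m.+1) psi F G i.+1 (tcoef (m - i) (subst F (tconst u))).
Proof.
set x := subst F (tconst u).
have /eqP : subst G (tderiv x + hder F G x) = 0.
  by rewrite -tderiv_subst (substKV substFM substF_inj FG) tderiv_tconst.
rewrite -tcoef_tderiv => /eqP /(congr1 (subst F)).
rewrite (substK substFM FG) linear0 => /eqP; rewrite addr_eq0 => /eqP->.
rewrite tcoefN; congr (- _).
(* [tcoef_kernel_op] sums over the exponent of [t] in the argument, the
   claim over that of [t] in [hder]. *)
rewrite [LHS]tcoef_kernel_op (reindex_inj rev_ord_inj) /=.
apply: eq_bigr => i _.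
by rewrite subSS subKn // -ltnS.
Qed.

End Flow.

(** * The expansions *)

Lemma diffop_linear n (M : monomType n) (K : comNzRingType) alpha
  (p : series M K -> series M K) : diffop alpha p -> linear p.
Proof.
elim=> {p} [d [] //| // |c p _ IH|p q _ IHp _ IHq|p q _ IHp _ IHq] k u v /=.
- by rewrite IH scalerDr !scalerA mulrC.
- by rewrite IHp IHq scalerDr addrACA.
- by rewrite IHq IHp.
Qed.

Lemma linear_fun0 (R : nzRingType) (U V : lmodType R) (f : U -> V) :
  linear f -> f 0 = 0.
Proof.
move=> f_lin; pose fL := GRing.isLinear.Build _ _ _ _ _ f_lin.
pose L : {linear U -> V} := HB.pack f fL.
exact: (linear0 L).
Qed.

Lemma mulrn_inv (K : comAlgType rat) (V : lmodType K) (x y : V) m :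
  x *+ m.+1 = y -> x = ((m.+1%:R^-1 : rat)%:A : K) *: y.
Proof.
move=> <-; rewrite -scaler_nat scalerA -(rmorph_nat (in_alg K)).
rewrite -[_%:A]/(in_alg K _) -rmorphM mulVf ?rmorph1 ?scale1r //.
by rewrite Num.Theory.pnatr_eq0.
Qed.

Theorem proposition5p4
    (K : comAlgType rat) (v : variables) (n : nat) (alpha : nat)
    (F G : 'I_n -> series (monom v n) {tps K})
    (lambda : nat -> series (monom v n) K -> series (monom v n) K)
    (u : series (monom v n) K) :
  (1 <= alpha)%N ->
  deformation alpha F ->
  inverse_map F G ->
  lambda_spec alpha F lambda ->
  [/\ subst F (tconst u) =
        tconst u + tsum1 (fun m => (-1) ^+ m *: lambda m u),
      subst F (tconst u) =
        tconst u + tsum1 (fun m => \sum_(I <- compositions m)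
          ((-1) ^+ size I / (pi_u (rev I))%:R)%:A *: oppow (psi F G) I u),
      subst G (tconst u) =
        tconst u + tsum1 (fun m => \sum_(I <- compositions m)
          ((-1) ^ ((size I)%:Z - m%:Z))%:A *: oppow lambda I u)
    & subst G (tconst u) =
        tconst u + tsum1 (fun m => \sum_(I <- compositions m)
          ((pi_u I)%:R^-1)%:A *: oppow (psi F G) I u)].
Proof.
move=> _ [[phi phi_bij phiE] _ _] FG [lambda_diff lambda0 lambdaE].
have substFE : subst F = phi by apply: funext => x; rewrite phiE.
have FM : monoid_morphism (subst F).
  by rewrite substFE; split; [apply: rmorph1 | apply: rmorphM].
have F_inj : injective (subst F) by rewrite substFE; apply: bij_inj.
have FGz i : subst F (G i) = zvar i by case: (FG i).
have lambda_lin m : linear (lambda m) := diffop_linear (lambda_diff m).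
have tcoefF m x :
    tcoef m (subst F x) =
    \sum_(j < m.+1) (-1) ^+ j *: lambda j (tcoef (m - j) x).
  by rewrite -lambdaE tcoef_tsum.
have coefF m w : tcoef m (subst F (tconst w)) = (-1) ^+ m *: lambda m w.
  rewrite tcoefF big_ord_recr /= subnn tcoef_tconst /= big1 ?add0r // => j _.
  rewrite tcoef_tconst subn_eq0 leqNgt ltn_ord /=.
  by rewrite linear_fun0 ?scaler0.
have coefF0 w : tcoef 0 (subst F (tconst w)) = w.
  by rewrite coefF expr0 scale1r lambda0.
have coefG0 w : tcoef 0 (subst G (tconst w)) = w.
  have := tcoefF 0%N (subst G (tconst w)).
  by rewrite (substK FM FGz) tcoef_tconst big_ord1 lambda0 scale1r => <-.
have inQM p q : p%:A * q%:A = (p * q)%:A :> K.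
  by rewrite -scalerAl mul1r scalerA.
have psi_lin m : linear (psi F G m) by apply: kernel_op_linear.
have expF := tsum1_expansion (coefF0 u).
have expG := tsum1_expansion (coefG0 u).
split; [apply: expF | apply: expF | apply: expG | apply: expG] => m.
- exact: coefF.
- rewrite -[compositions m.+1]/(compositions0 m.+1).
  pose b (k i : nat) : K := (- k.+1%:R^-1)%:A.
  rewrite (@left_recursion _ _ _ (psi F G) b
    (fun I => ((-1) ^+ size I / (pi_u (rev I))%:R)%:A) _
    (fun m => tcoef m (subst F (tconst u)))) ?coefF0 //.
  + by rewrite /pi_u big_ord0 expr0 divr1 scale1r.
  + move=> i J; rewrite /b inQM rev_cons pi_u_rcons sumn_rev.
    rewrite addnS [(sumn J + i)%N]addnC natrM invfM exprS mulN1r !mulNr mulrA.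
    by rewrite [X in (- X)%:A]mulrC.
  + move=> k; rewrite (mulrn_inv (tcoef_subst_direct FM F_inj FGz u k)).
    by rewrite scalerN -!scaleNr scaler_sumr.
- rewrite -[compositions m.+1]/(compositions0 m.+1).
  pose b (k i : nat) : K := (-1) ^+ i.
  rewrite (@left_recursion _ _ _ lambda b
    (* The recursion needs coefficients that depend on the composition
       alone, so [m] is written as its sum. *)
    (fun I => ((-1) ^ ((size I)%:Z - (sumn I)%:Z))%:A) _
    (fun m => tcoef m (subst G (tconst u)))) ?coefG0 //.
  + apply: eq_big_seq => I; rewrite mem_compositions0 => /andP[_ /eqP ->].
    by [].
  + by rewrite expr0z scale1r.
  + move=> i J /=; rewrite /b -[(-1) ^+ i](rmorph_sign (in_alg K)) inQM.
    congr (_ %:A); rewrite -[(size J).+1]add1n -[i.+1]add1n -addnA !PoszD.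
    rewrite opprD addrACA subrr add0r opprD addrCA expfzDr //; congr (_ * _).
    by rewrite -invr_expz -exprnP -exprVn invrN1.
  + move=> k; have := tcoefF k.+1 (subst G (tconst u)).
    rewrite (substK FM FGz) tcoef_tconst big_ord_recl /= lambda0 scale1r subn0.
    move/esym/eqP; rewrite addr_eq0 => /eqP ->; rewrite -sumrN.
    by apply: eq_bigr => i _; rewrite /b exprS mulN1r scaleNr opprK subSS.
- rewrite -[compositions m.+1]/(compositions0 m.+1).
  pose b (k i : nat) : K := (k.+1%:R^-1)%:A.
  apply: (@right_recursion _ _ _ (psi F G) b
    (fun I => (pi_u I)%:R^-1%:A) _
    (fun m u => tcoef m (subst G (tconst u)))) => //.
  + by rewrite /pi_u big_ord0 invr1 scale1r.
  + move=> i J; rewrite /b inQM pi_u_rcons.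
    by rewrite addnS [(sumn J + i)%N]addnC natrM invfM mulrC.
  + move=> k w; rewrite (mulrn_inv (tcoef_subst_inverse FM F_inj FGz w k)).
    by rewrite scaler_sumr.
Qed.
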